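(* Let $A,B\in\mathbb{C}^{d\times d}$ be Hermitian matrices and let $(a_i)_{i=1}^d$ and $(b_j)_{j=1}^d$ be orthonormal eigenbases of $A$ and $B$, respectively, with $Aa_i=\lambda_i(A)a_i$ and $Bb_j=\lambda_j(B)b_j$. Then $$\lambda_{\max}(A+B)\le\max\big\{\lambda_i(A)+\lambda_j(B)\;\big|\;i,j\in\{1,\dots,d\},\ \langle a_i,b_j\rangle\ne0\big\}.$$
   Context: For a Hermitian $X\in\mathbb{C}^{d\times d}$, $\lambda_1(X)\ge\cdots\ge\lambda_d(X)$ are its eigenvalues (with multiplicity) in decreasing order, and $\lambda_{\max}(X)=\lambda_1(X)$. *)

(* Defs.v *)
From mathcomp Require Import all_boot all_order all_algebra.
From mathcomp Require Import all_classical all_reals.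
From mathcomp Require Import complex.

Set Implicit Arguments.
Unset Strict Implicit.
Unset Printing Implicit Defensive.

Import Order.TTheory GRing.Theory Num.Theory.
Local Open Scope ring_scope.
Local Open Scope complex_scope.
Local Open Scope sesquilinear_scope.

(* The roots of the characteristic polynomial, repeated according to their    *)
(* multiplicity, in an unspecified order.                                     *)
Definition eigenvalues (R : realType) (d : nat) (A : 'M[R[i]]_d) : seq R[i] :=
  sval (closed_field_poly_normal (char_poly A)).

(* [lambda A k] is the (k+1)-st largest eigenvalue of a Hermitian A, so k     *)
(* ranges over 0, ..., d-1. Taking real parts only changes the type of the    *)
(* eigenvalues, which are real for Hermitian A: see [char_poly_lambda]. The   *)
(* value is 0 by default when k >= d.                                         *)
Definition lambda (R : realType) (d : nat) (A : 'M[R[i]]_d) (k : nat) : R :=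
  (sort >=%R [seq complex.Re z | z <- eigenvalues A])`_k.

Definition lambda_max (R : realType) (d : nat) (A : 'M[R[i]]_d) : R :=
  lambda A 0.

Definition cdot (R : realType) (d : nat) (u v : 'cV[R[i]]_d) : R[i] :=
  (u ^t* *m v) 0 0.

Definition orthonormal_basis (R : realType) (d : nat)
    (u : 'I_d -> 'cV[R[i]]_d) : Prop :=
  (forall i j, cdot (u i) (u j) = (i == j)%:R) /\
  basis_of fullv [seq u i | i : 'I_d].

Section Sanity.
Variables (R : realType) (d : nat) (A : 'M[R[i]]_d).

Lemma char_poly_eigenvalues :
  char_poly A = \prod_(z <- eigenvalues A) ('X - z%:P).
Proof.
rewrite /eigenvalues; case: closed_field_poly_normal => r /= {1}->.
by rewrite (monicP (char_poly_monic A)) scale1r.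
Qed.

Lemma size_eigenvalues : size (eigenvalues A) = d.
Proof.
by have := size_char_poly A; rewrite char_poly_eigenvalues size_prod_XsubC => -[].
Qed.

Lemma lambda_sorted (i j : nat) : (i <= j < d)%N -> lambda A j <= lambda A i.
Proof.
move=> /andP[ij jd]; rewrite /lambda.
set s := [seq _ | _ <- _].
have ss : size s = d by rewrite size_map size_eigenvalues.
have so : sorted >=%R (sort >=%R s).
  by apply: sort_sorted => x y; exact: le_total.
have ge_trans : transitive (>=%R : rel R) by move=> x y z xy yz; exact: le_trans yz xy.
have id_ : (i < d)%N by exact: leq_ltn_trans jd.
by apply: (sorted_leq_nth ge_trans (lexx (T:=R)) 0 so); rewrite ?inE ?size_sort ?ss.
Qed.

Hypothesis hA : A \is hermsymmx.

Lemma eigenvalue_hermitian_real (z : R[i]) :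
  eigenvalue A z -> z \is Num.real.
Proof.
move=> /eigenvalueP[v vA v0].
have AE : A = A ^t* by have /is_hermitianmxP := hA; rewrite scale1r.
have vN : dotmx v v != 0 by rewrite gt_eqF // dotmx_is_dotmx.
have dE : dotmx v v = (v *m v ^t* ) 0 0 by rewrite dotmxE.
have e1 : (v *m A *m v ^t* ) 0 0 = z * dotmx v v.
  by rewrite vA -scalemxAl mxE dE.
have e2 : (v *m A *m v ^t* ) 0 0 = z^*%R * dotmx v v.
  have -> : v *m A *m v ^t* = v *m (v *m A) ^t*.
    by rewrite trmx_mul map_mxM -AE mulmxA.
  rewrite vA dE.
  have -> : (z *: v) ^t* = z^*%R *: v ^t*.
    by apply/matrixP => i j; rewrite !mxE rmorphM.
  by rewrite -scalemxAr mxE.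
by apply/CrealP; apply: (mulIf vN); rewrite -e1 -e2.
Qed.

Lemma char_poly_lambda :
  char_poly A = \prod_(i < d) ('X - ((lambda A i)%:C)%:P).
Proof.
set s := [seq complex.Re z | z <- eigenvalues A].
have sE : perm_eq (eigenvalues A) [seq x%:C | x <- sort >=%R s].
  have h : eigenvalues A = [seq x%:C | x <- s].
    rewrite -map_comp -[LHS]map_id; apply/eq_in_map => z zA /=.
    rewrite RRe_real //; apply: eigenvalue_hermitian_real.
    by rewrite eigenvalue_root_char char_poly_eigenvalues root_prod_XsubC.
  by rewrite {1}h perm_map // perm_sym perm_sort.
rewrite char_poly_eigenvalues (perm_big _ sE) big_map (big_nth 0).
by rewrite size_sort size_map size_eigenvalues big_mkord.
Qed.

End Sanity.

(* Main.v *)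
(** For a vector [w], the weights [p_i = |<a_i, w>|^2] and [q_j = |<b_j, w>|^2]
    have the same total mass. Given a threshold [k], let [J] be the set of the
    [j] such that [b_j] is orthogonal to [a_0, ..., a_k]. The coordinates of [w]
    along [b_j], [j \in J], only depend on the projection of [w] to the span of
    the [a_i], [i > k], so [q(J) <= p({i > k})]. If [<a_i, b_j> != 0] implies
    [lambda_i(A) <= M - lambda_j(B)], summing these inequalities by parts against
    the decreasing sequence [lambda_i(A)] gives [<w, A w> <= <w, (M - B) w>]; then
    take for [w] an eigenvector of [A + B] for its largest eigenvalue. *)

Require Import Defs.
From mathcomp Require Import all_boot all_order all_algebra.
From mathcomp Require Import all_classical all_reals.
From mathcomp Require Import complex.

Local Open Scope ring_scope.
Local Open Scope complex_scope.
Local Open Scope ereal_scope.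

Import Order.TTheory GRing.Theory Num.Theory.
Local Open Scope sesquilinear_scope.
Local Open Scope ring_scope.

Lemma summation_by_parts (V : pzRingType) (n : nat) (f : nat -> V) (i : nat) :
  (i <= n)%N -> f i = f 0%N - \sum_(k < n) (f k - f k.+1) * (k < i)%:R.
Proof.
move=> le_in; rewrite -(big_mkord xpredT (fun k => (f k - f k.+1) * (k < i)%:R)).
rewrite (big_cat_nat (n := i)) //= [X in _ - (_ + X)]big_nat_cond.
rewrite [X in _ - (_ + X)]big1 => [|k /andP[/andP[ik _] _]]; last first.
  by rewrite ltnNge ik mulr0.
rewrite addr0 big_nat_cond (eq_bigr (fun k => - (f k.+1 - f k))); last first.
  by move=> k /andP[/andP[_ ->] _]; rewrite mulr1 opprB.
by rewrite -big_nat_cond sumrN opprK telescope_sumr // addrC subrK.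
Qed.

Lemma char_poly_tr (K : comNzRingType) (n : nat) (A : 'M[K]_n) :
  char_poly A^T = char_poly A.
Proof.
rewrite /char_poly -det_tr; congr (\det _).
by apply/matrixP => i j; rewrite !mxE eq_sym.
Qed.

Section HermitianForms.
Variable R : realType.

Lemma cdotE (d : nat) (u v : 'cV[R[i]]_d) :
  cdot u v = \sum_i (u i 0)^*%R * v i 0.
Proof. by rewrite /cdot mxE; apply: eq_bigr => i _; rewrite !mxE. Qed.

Lemma cdot_sqr (d : nat) (u : 'cV[R[i]]_d) :
  cdot u u = \sum_i `|u i 0| ^+ 2.
Proof. by rewrite cdotE; apply: eq_bigr => i _; rewrite normCK mulrC. Qed.

Lemma cdot_isometry (d : nat) (W : 'M[R[i]]_d) (u v : 'cV[R[i]]_d) :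
  W ^t* *m W = 1%:M -> cdot (W *m u) (W *m v) = cdot u v.
Proof.
by move=> WW; rewrite /cdot trmx_mul map_mxM -mulmxA (mulmxA (W ^t*)) WW mul1mx.
Qed.

Lemma cdot_diag (d : nat) (D : 'rV[R[i]]_d) (u : 'cV[R[i]]_d) :
  cdot u (diag_mx D *m u) = \sum_i D 0 i * `|u i 0| ^+ 2.
Proof.
rewrite cdotE; apply: eq_bigr => i _.
by rewrite mul_diag_mx mxE normCK mulrCA [X in _ * X]mulrC.
Qed.

Lemma unitary_tail_mass (d : nat) (W : 'M[R[i]]_d) (y : 'cV[R[i]]_d)
    (I J : pred 'I_d) :
  W ^t* *m W = 1%:M -> (forall i j, I i -> J j -> W i j = 0) ->
  \sum_(j | J j) `|y j 0| ^+ 2 <= \sum_(i | ~~ I i) `|(W *m y) i 0| ^+ 2.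
Proof.
move=> WW W0; set x := W *m y.
pose x' : 'cV_d := \col_i (if I i then 0 else x i 0).
have -> : \sum_(i | ~~ I i) `|x i 0| ^+ 2 = cdot x' x'.
  rewrite cdot_sqr big_mkcond; apply: eq_bigr => i _.
  by rewrite [x' i 0]mxE; case: (I i) => //; rewrite normr0 expr0n.
have WW' : W *m W ^t* = 1%:M by exact: mulmx1C.
rewrite -(@cdot_isometry _ (W ^t*)); last by rewrite trmxCK.
rewrite cdot_sqr [leRHS](bigID J) -[leLHS]addr0 lerD //; last first.
  by apply: sumr_ge0 => i _; rewrite exprn_ge0.
rewrite le_eqVlt; apply/orP; left; apply/eqP; apply: eq_bigr => j Jj.
have -> : y = W ^t* *m x by rewrite mulmxA WW mul1mx.
rewrite !mxE; congr (`|_| ^+ 2); apply: eq_bigr => i _; rewrite !mxE.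
by case: ifP => // Ii; rewrite (W0 i j) // conjC0 !mul0r.
Qed.

Lemma unitary_diag_le (n : nat) (W : 'M[R[i]]_n.+1) (y : 'cV[R[i]]_n.+1)
    (f : nat -> R[i]) (c : 'I_n.+1 -> R[i]) :
  W ^t* *m W = 1%:M -> (forall k, (k < n)%N -> f k.+1 <= f k) ->
  (forall (i j : 'I_n.+1), W i j != 0 -> f i <= c j) ->
  \sum_(i < n.+1) f i * `|(W *m y) i 0| ^+ 2
    <= \sum_(j < n.+1) c j * `|y j 0| ^+ 2.
Proof.
move=> WW fdec fc; set x := W *m y.
have Wcol j : exists i, W i j != 0.
  apply/existsP; apply: contraT; rewrite negb_exists => /forallP Wj0.
  have /matrixP/(_ j j) := WW; rewrite !mxE eqxx big1 => [/eqP|i _].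
    by rewrite eq_sym oner_eq0.
  by have := Wj0 i; rewrite negbK => /eqP ->; rewrite mulr0.
have [m Wm mmin] : exists2 m : 'I_n.+1 -> 'I_n.+1,
    forall j, W (m j) j != 0 & forall i j, W i j != 0 -> (m j <= i)%N.
  have ex j : exists m : 'I_n.+1,
      (W m j != 0) && [forall i : 'I_n.+1, (W i j != 0) ==> (m <= i)%N].
    have [i0 Wi0] := Wcol j.
    case: (@arg_minnP _ i0 (fun i => W i j != 0) (fun i => nat_of_ord i) Wi0).
    move=> m Wm mle; exists m; rewrite Wm; apply/forallP => i.
    by apply/implyP; exact: mle.
  exists (fun j => xchoose (ex j)) => [j|i j Wij].
    by have /andP[] := xchooseP (ex j).
  by have /andP[_ /forallP/(_ i)/implyP/(_ Wij)] := xchooseP (ex j).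
have xy : \sum_i `|x i 0| ^+ 2 = \sum_j `|y j 0| ^+ 2.
  by rewrite -!cdot_sqr cdot_isometry.
have expand (h : 'I_n.+1 -> 'I_n.+1) (z : 'cV[R[i]]_n.+1) :
    \sum_i f (h i) * `|z i 0| ^+ 2 = f 0%N * (\sum_i `|z i 0| ^+ 2) -
    \sum_(k < n) (f k - f k.+1) * \sum_(i | (k < h i)%N) `|z i 0| ^+ 2.
  under [X in _ - X]eq_bigr => k _ do rewrite mulr_sumr big_mkcond.
  rewrite exchange_big mulr_sumr -sumrB; apply: eq_bigr => i _.
  rewrite (@summation_by_parts _ n f (h i)) -1?ltnS // mulrBl mulr_suml.
  congr (_ - _); apply: eq_bigr => k _.
  by case: ifP; rewrite ?mulr1 // mulr0 mul0r.
apply: (@le_trans _ _ (\sum_j f (m j) * `|y j 0| ^+ 2)); last first.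
  by apply: ler_sum => j _; rewrite ler_wpM2r ?exprn_ge0 ?fc.
rewrite (expand id) expand xy lerD2l lerN2; apply: ler_sum => k _.
rewrite ler_wpM2l ?subr_ge0 ?fdec //.
under [leRHS]eq_bigl => i do rewrite ltnNge.
apply: unitary_tail_mass => // i j ik kj.
apply/eqP; apply: contraTT kj => /mmin mji.
by rewrite -leqNgt (leq_trans mji).
Qed.

Lemma orthonormal_unitary (d : nat) (u : 'I_d -> 'cV[R[i]]_d) :
  orthonormal_basis u ->
  let U := \matrix_(i, j) u j i 0 in U ^t* *m U = 1%:M.
Proof.
move=> [uu _] U; apply/matrixP => i j; rewrite [RHS]mxE -uu cdotE mxE.
by apply: eq_bigr => k _; rewrite !mxE.
Qed.

Lemma eigenbasis_diag (d : nat) (A : 'M[R[i]]_d) (u : 'I_d -> 'cV[R[i]]_d)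
    (D : 'rV[R[i]]_d) :
  (forall i, A *m u i = D 0 i *: u i) ->
  let U := \matrix_(i, j) u j i 0 in A *m U = U *m diag_mx D.
Proof.
move=> Au U; apply/matrixP => i j.
have /matrixP/(_ i 0) := Au j; rewrite mul_mx_diag !mxE mulrC => <-.
by apply: eq_bigr => k _; rewrite !mxE.
Qed.

Lemma cdot_eigenbasis (d : nat) (A : 'M[R[i]]_d) (u : 'I_d -> 'cV[R[i]]_d)
    (D : 'rV[R[i]]_d) (w : 'cV[R[i]]_d) :
  orthonormal_basis u -> (forall i, A *m u i = D 0 i *: u i) ->
  let U := \matrix_(i, j) u j i 0 in
  cdot w (A *m w) = \sum_i D 0 i * `|(U ^t* *m w) i 0| ^+ 2.
Proof.
move=> uo Au U; have UU : U *m U ^t* = 1%:M.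
  by apply: mulmx1C; exact: orthonormal_unitary.
rewrite -cdot_diag -[LHS](@cdot_isometry _ (U ^t*)); last by rewrite trmxCK.
congr (cdot _ _); rewrite -[in LHS](mul1mx w) -UU !mulmxA.
rewrite -(mulmxA (U ^t*) A U) (eigenbasis_diag _ _ _ _ Au) mulmxA.
by rewrite orthonormal_unitary // mul1mx.
Qed.

Lemma hermsymmxD (d : nat) (A B : 'M[R[i]]_d) :
  A \is hermsymmx -> B \is hermsymmx -> A + B \is hermsymmx.
Proof.
move=> /is_hermitianmxP hA /is_hermitianmxP hB; apply/is_hermitianmxP.
by move: hA hB; rewrite !scale1r => {1}-> {1}->; rewrite linearD map_mxD.
Qed.

Lemma lambda_max_eigenvector (n : nat) (A : 'M[R[i]]_n.+1) :
  A \is hermsymmx ->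
  exists2 w : 'cV[R[i]]_n.+1, w != 0 & A *m w = (lambda_max A)%:C *: w.
Proof.
move=> hA; have : eigenvalue A^T (lambda_max A)%:C.
  rewrite eigenvalue_root_char char_poly_tr char_poly_lambda //.
  by rewrite big_ord_recl rootM root_XsubC eqxx.
move=> /eigenvalueP[v vA v0]; exists v^T; first by rewrite trmx_eq0.
by rewrite -[LHS]trmxK trmx_mul trmxK vA linearZ.
Qed.

Lemma lambda_max_add_le (d : nat) (A B : 'M[R[i]]_d)
    (a b : 'I_d -> 'cV[R[i]]_d) (M : R) :
  (0 < d)%N -> A \is hermsymmx -> B \is hermsymmx ->
  orthonormal_basis a -> orthonormal_basis b ->
  (forall i : 'I_d, A *m a i = (lambda A i)%:C *: a i) ->
  (forall j : 'I_d, B *m b j = (lambda B j)%:C *: b j) ->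
  (forall i j : 'I_d, cdot (a i) (b j) != 0 -> lambda A i + lambda B j <= M) ->
  lambda_max (A + B) <= M.
Proof.
case: d A B a b => // n A B a b _ hA hB ao bo Aa Bb leM.
have [w w0 ABw] := lambda_max_eigenvector _ _ (hermsymmxD _ _ _ hA hB).
pose DA : 'rV[R[i]]_n.+1 := \row_i (lambda A i)%:C.
pose DB : 'rV[R[i]]_n.+1 := \row_i (lambda B i)%:C.
pose Ua : 'M[R[i]]_n.+1 := \matrix_(i, j) a j i 0.
pose Ub : 'M[R[i]]_n.+1 := \matrix_(i, j) b j i 0.
have wA : cdot w (A *m w) = \sum_i DA 0 i * `|(Ua ^t* *m w) i 0| ^+ 2.
  by apply: cdot_eigenbasis => // i; rewrite mxE Aa.
have wB : cdot w (B *m w) = \sum_i DB 0 i * `|(Ub ^t* *m w) i 0| ^+ 2.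
  by apply: cdot_eigenbasis => // i; rewrite mxE Bb.
have Uaa : Ua *m Ua ^t* = 1%:M by apply: mulmx1C; exact: orthonormal_unitary.
have Ubb : Ub *m Ub ^t* = 1%:M by apply: mulmx1C; exact: orthonormal_unitary.
pose y := Ub ^t* *m w.
have yw : \sum_j `|y j 0| ^+ 2 = cdot w w.
  by rewrite -cdot_sqr cdot_isometry // trmxCK.
have ww : 0 < cdot w w.
  rewrite lt_def cdot_sqr sumr_ge0 ?andbT => [|i _]; last exact: exprn_ge0.
  apply: contraNneq w0 => /eqP.
  rewrite psumr_eq0 => [/allP wz|i _]; last exact: exprn_ge0.
  apply/eqP/colP => i; apply/eqP; have := wz i (mem_index_enum i).
  by rewrite sqrf_eq0 normr_eq0 mxE.
pose W := Ua ^t* *m Ub.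
have WW : W ^t* *m W = 1%:M.
  rewrite trmx_mul map_mxM trmxCK mulmxA -(mulmxA (Ub ^t*)) Uaa mulmx1.
  exact: orthonormal_unitary.
have Wy : W *m y = Ua ^t* *m w by rewrite mulmxA -(mulmxA _ Ub) Ubb mulmx1.
have le : cdot w (A *m w) <= \sum_j (M%:C - DB 0 j) * `|y j 0| ^+ 2.
  rewrite wA -Wy.
  under eq_bigr => i _ do rewrite mxE.
  apply: (unitary_diag_le _ _ _ (fun k => (lambda A k)%:C)) => // [k kn|i j Wij].
    by rewrite lecR lambda_sorted // leqnSn.
  rewrite mxE -rmorphB lecR lerBrDr leM //.
  move: Wij; congr (_ != 0); rewrite cdotE mxE.
  by apply: eq_bigr => k _; rewrite !mxE.
rewrite -lecR -(ler_pM2r ww).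
have <- : cdot w (A *m w) + cdot w (B *m w) = (lambda_max (A + B))%:C * cdot w w.
  transitivity (cdot w ((A + B) *m w)).
    by rewrite /cdot mulmxDl mulmxDr [RHS]mxE.
  by rewrite ABw /cdot -scalemxAr mxE.
rewrite -lerBrDr (le_trans le) // wB -yw mulr_sumr -sumrB.
by rewrite le_eqVlt; apply/orP; left; apply/eqP; apply: eq_bigr => j _; rewrite mulrBl.
Qed.

End HermitianForms.

Local Open Scope ereal_scope.

Theorem lemma1 (R : realType) (d : nat) (A B : 'M[R[i]]_d)
    (a b : 'I_d -> 'cV[R[i]]_d)
    (hd : (0 < d)%N)
    (hA : A \is hermsymmx) (hB : B \is hermsymmx)
    (ha : orthonormal_basis a) (hb : orthonormal_basis b)
    (hAa : forall i : 'I_d, A *m a i = (lambda A i)%:C%C *: a i)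
    (hBb : forall j : 'I_d, B *m b j = (lambda B j)%:C%C *: b j) :
  (lambda_max (A + B)%R)%:E <=
    \big[maxe/-oo]_(p : 'I_d * 'I_d | cdot (a p.1) (b p.2) != 0%R)
      (lambda A p.1 + lambda B p.2)%R%:E.
Proof.
set m := \big[maxe/-oo]_(_ | _) _.
have le_m (i j : 'I_d) : cdot (a i) (b j) != 0%R ->
    (lambda A i + lambda B j)%R%:E <= m.
  move=> ab; exact: (@le_bigmax_cond _ _ _ _ (i, j)
    (fun p => cdot (a p.1) (b p.2) != 0%R)
    (fun p => (lambda A p.1 + lambda B p.2)%R%:E)).
have bound M := lambda_max_add_le R d A B a b M hd hA hB ha hb hAa hBb.
case: m le_m => [M||] le_m; first 2 last.
- suff : (lambda_max (A + B) <= lambda_max (A + B) - 1)%R.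
    by rewrite lerBrDr gerDl ler10.
  by apply: bound => i j /le_m.
- by rewrite lee_fin bound // => i j /le_m; rewrite lee_fin.
- by rewrite leey.
Qed.
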